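(* Let $P=(X,\prec)$ be a poset with $|X|=n>2$ elements. Fix an element $a\in X$ and an integer $1\le k\le n-2$. Then for every pair of distinct elements $x,y$ that are minimal elements of the induced subposet on $X\setminus\{a\}$, we have $$e_k(P)\,e_k(P-x-y)\ \le\ 2\,e_k(P-x)\,e_k(P-y).$$
   Context: A linear extension of a poset $Q=(Y,\prec)$ with $|Y|=m$ is a bijection $g:Y\to\{1,\dots,m\}$ such that $u\prec v$ implies $g(u)<g(v)$. For any induced subposet $Q$ of $P$ containing the fixed element $a$, $e_k(Q)$ denotes the number of linear extensions $g$ of $Q$ with $g(a)=k$. $P-x$ denotes the induced subposet on $X\setminus\{x\}$ and $P-x-y$ the induced subposet on $X\setminus\{x,y\}$. *)

(* Defs.v *)
From HB Require Import structures.
From mathcomp Require Import all_boot all_order.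

Set Implicit Arguments.
Unset Strict Implicit.
Unset Printing Implicit Defensive.

Section Defs.
Context {d : Order.disp_t} {T : finPOrderType d}.

(* An induced subposet is given by its ground set A : {set T}.  The position  *)
(* i : 'I_#|A| stands for the label i.+1 in {1, ..., #|A|}.                   *)
Definition linear_extension (A : {set T})
    (g : {ffun {u : T | u \in A} -> 'I_#|A|}) : bool :=
  [&& injectiveb g,
      [forall i, exists u, g u == i] &
      [forall u, forall v, (val u < val v)%O ==> (g u < g v)%N]].

Definition linext_count (a : T) (k : nat) (A : {set T}) : nat :=
  #|[set g : {ffun {u : T | u \in A} -> 'I_#|A|} |
      linear_extension g &&
      [exists u, (val u == a) && ((g u).+1 == k)]]|.

Definition minimal_in (A : {set T}) (x : T) : Prop :=
  x \in A /\ forall z : T, z \in A -> ~~ (z < x)%O.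

End Defs.

(* Main.v *)
Require Import Defs.
From HB Require Import structures.
From mathcomp Require Import all_boot all_order all_algebra.
From mathcomp Require Import ring lra zify.

(** The inequality is an Alexandrov-Fenchel type inequality, obtained in the
    style of the combinatorial atlas of Chan and Pak.  On [Q := X \ {a}]
    consider the process which repeatedly removes a minimal element (from
    below) or a maximal element (from above).  With a suitable weight per
    removal, the total weight of all complete removals is [e_k], and leaving
    the first two removals free defines a symmetric bilinear form on functions
    of the removable elements.  If this form is hyperbolic (it satisfies the
    reversed Cauchy-Schwarz inequality), then comparing the vector of one
    removal from above with the coordinate vectors of [x] and [y] gives
    [A d <= 2 b c], where [A = e_k(P)], [d = e_k(P-x-y)], [b = e_k(P-x)] and
    [c = e_k(P-y)]; the factor 2 comes from dropping nonnegative diagonal terms.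

    Hyperbolicity is proved by induction on [|Q|].  The forms of the posets
    [Q - u] being hyperbolic, a Bochner type inequality [M D^-1 M >= M] holds
    for the matrix [M] of [Q], where [M h = D h] with [h > 0] and [D] diagonal;
    since [M] is nonnegative and irreducible, this forces [M <= 0] on the
    orthogonal complement of [D h].

    The argument needs positive weights, while [e_k] forbids the removal of
    elements above [a] from below, of elements below [a] from above, and fixes
    the side of each removal.  Forbidden removals therefore get a small weight
    [e > 0], and [e] tends to [0] at the end. *)

Set Implicit Arguments.
Unset Strict Implicit.
Unset Printing Implicit Defensive.

Import Order.TTheory GRing.Theory Num.Theory.
Local Open Scope ring_scope.

(** * Hyperbolic forms and a Bochner criterion *)

Section Hyperbolic.
Variables (R : realFieldType) (I : finType).
Implicit Types (f g h : I -> R) (M : I -> I -> R).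

(** For a symmetric form this amounts to having at most one positive eigenvalue. *)
Definition hyperbolic (B : (I -> R) -> (I -> R) -> R) : Prop :=
  forall f g, 0 < B g g -> B f f * B g g <= B f g ^+ 2.

Definition mxform M f g : R := \sum_u f u * \sum_v M u v * g v.

Lemma mxformC M f g : (forall u v, M u v = M v u) -> mxform M f g = mxform M g f.
Proof.
move=> symM; rewrite /mxform.
under eq_bigr do rewrite mulr_sumr.
rewrite exchange_big; apply: eq_bigr => v _ /=; rewrite mulr_sumr.
by apply: eq_bigr => u _; rewrite (symM u v); ring.
Qed.

Lemma mxform_linr M f g1 g2 (c1 c2 : R) :
  mxform M f (fun u => c1 * g1 u + c2 * g2 u) =
  c1 * mxform M f g1 + c2 * mxform M f g2.
Proof.
rewrite /mxform !mulr_sumr -big_split /=; apply: eq_bigr => u _.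
have -> : \sum_v M u v * (c1 * g1 v + c2 * g2 v) =
    c1 * (\sum_v M u v * g1 v) + c2 * (\sum_v M u v * g2 v).
  by rewrite !mulr_sumr -big_split; apply: eq_bigr => v _ /=; ring.
by ring.
Qed.

Lemma mxform_comb M f g (c1 c2 : R) :
    (forall u v, M u v = M v u) ->
  let k := fun u => c1 * f u + c2 * g u in
  mxform M k k =
    c1 ^+ 2 * mxform M f f + c1 * c2 * mxform M f g *+ 2 + c2 ^+ 2 * mxform M g g.
Proof.
move=> symM /=; set k := fun u => _.
rewrite {2}/k mxform_linr (mxformC k f symM) (mxformC k g symM) !mxform_linr.
by rewrite (mxformC g f symM); ring.
Qed.

Lemma mxform_cauchy_schwarz M f g :
    (forall u v, M u v = M v u) -> (forall k, 0 <= mxform M k k) ->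
  mxform M f g ^+ 2 <= mxform M f f * mxform M g g.
Proof.
move=> symM psdM.
have := mxform_comb f g _ _ symM => comb.
have [g0|gn0] := eqVneq (mxform M g g) 0.
  have [->|fgn0] := eqVneq (mxform M f g) 0; first by rewrite g0 expr0n mulr0.
  (* With [g] isotropic, this coefficient makes the value of the form [- p - 2], where [p >= 0] is
     its value at [f]. *)
  have := psdM (fun u => 1 * f u + (- (mxform M f f + 1) / mxform M f g) * g u).
  rewrite comb g0 mul1r divfK //; have := psdM f.
  set p := mxform M f f; lra.
have gp : 0 < mxform M g g by rewrite lt_neqAle eq_sym gn0 psdM.
have := psdM (fun u => mxform M g g * f u + (- mxform M f g) * g u).
rewrite comb; set p := mxform M f f; set q := mxform M f g.
move: gp; set r := mxform M g g => gp.
have -> : r ^+ 2 * p + r * - q * q *+ 2 + (- q) ^+ 2 * r = r * (p * r - q ^+ 2) by ring.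
by rewrite pmulr_rge0 // subr_ge0.
Qed.

(** Some combination of [f] and [g] is orthogonal to [h]. Its coefficient at [f] is nonzero, since
    [g], having a positive value, cannot itself be orthogonal to [h]. *)
Lemma hyperbolic_of_orthogonal M h :
    (forall u v, M u v = M v u) ->
    (forall f, mxform M f h = 0 -> mxform M f f <= 0) ->
  hyperbolic (mxform M).
Proof.
move=> symM neg f g gp.
have := neg (fun u => mxform M g h * f u + (- mxform M f h) * g u).
rewrite mxform_comb // (mxformC _ h symM) mxform_linr.
rewrite (mxformC h f symM) (mxformC h g symM).
have -> : mxform M g h * mxform M f h + - mxform M f h * mxform M g h = 0 by ring.
move=> /(_ erefl).
have := neg g.
set al := mxform M g h; set be := mxform M f h.
move: gp; set ff := mxform M f f; set gg := mxform M g g; set fg := mxform M f g.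
move=> gp al0 le0; rewrite leNgt; apply/negP => lt0.
have al2 : 0 < al ^+ 2.
  by rewrite exprn_even_gt0 //=; apply/eqP => /al0; rewrite leNgt gp.
have : gg * (al ^+ 2 * ff + al * - be * fg *+ 2 + (- be) ^+ 2 * gg) <= 0.
  by rewrite pmulr_rle0.
have -> : gg * (al ^+ 2 * ff + al * - be * fg *+ 2 + (- be) ^+ 2 * gg)
   = (be * gg - al * fg) ^+ 2 + al ^+ 2 * (ff * gg - fg ^+ 2) by ring.
apply/negP; rewrite -ltNge ltr_wpDl ?sqr_ge0 // mulr_gt0 // subr_gt0 //.
Qed.

(** Fredholm alternative: the image of a symmetric matrix is the orthogonal complement of its
    kernel. *)
Lemma symmetric_solve M g :
    (forall u v, M u v = M v u) ->
    (forall k, (forall u, \sum_v M u v * k v = 0) -> \sum_u g u * k u = 0) ->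
  exists f, forall u, \sum_v M u v * f v = g u.
Proof.
move=> symM orth.
pose A : 'M[R]_#|I| := \matrix_(i, j) M (enum_val i) (enum_val j).
pose b : 'rV[R]_#|I| := \row_i g (enum_val i).
have sumE (F : I -> R) : \sum_u F u = \sum_(i < #|I|) F (enum_val i).
  by rewrite (reindex_onto enum_rank enum_val) /=;
    [apply: eq_big => [u|u _]; rewrite ?enum_rankK ?eqxx | move=> i _; rewrite enum_valK].
have /submxP[f bE] : (b <= A)%MS.
  rewrite submxE; apply/eqP/matrixP => i j; rewrite !mxE.
  (* The columns of the cokernel matrix are annihilated by [A], so each is an admissible [k]. *)
  rewrite -[RHS](orth (fun u => cokermx A (enum_rank u) j)) => [|u].
    by rewrite sumE; apply: eq_bigr => l _; rewrite !mxE enum_valK.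
  have /matrixP/(_ (enum_rank u) j) := mulmx_coker A; rewrite !mxE => {2}<-.
  by rewrite sumE; apply: eq_bigr => l _; rewrite !mxE enum_valK enum_rankK.
exists (fun u => f 0 (enum_rank u)) => u.
have /matrixP/(_ 0 (enum_rank u)) := bE; rewrite !mxE enum_rankK => ->.
rewrite sumE; apply: eq_bigr => l _.
by rewrite !mxE enum_valK enum_rankK symM mulrC.
Qed.

(* With [d := M h / h] and [L := diag d - M], the hypotheses say that [L] is
   positive semidefinite with kernel spanned by [h], and [L D^-1 L >= L].  If
   [g] is orthogonal to [D h], then [D g = L f] for some [f], and
   Cauchy-Schwarz for [L] gives
   [(g D g)^2 = (g L f)^2 <= (g L g) (f L f) <= (g L g) (g D g)]. *)
Lemma hyperbolic_bochner M h :
    (forall u v, M u v = M v u) -> (forall u v, 0 <= M u v) ->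
    (forall u, 0 < h u) ->
    (forall f, (forall u v, 0 < M u v -> f u = f v) ->
       forall u v, 0 < \sum_z M u z * h z -> 0 < \sum_z M v z * h z -> f u = f v) ->
    (forall f, mxform M f f <=
       \sum_u h u * (\sum_v M u v * f v) ^+ 2 / (\sum_v M u v * h v)) ->
  hyperbolic (mxform M).
Proof.
move=> symM geM hp conn boch.
pose e u := \sum_v M u v * h v.
pose d u := e u / h u.
have e_ge0 u : 0 <= e u by apply: sumr_ge0 => v _; rewrite mulr_ge0 // ltW.
have d_ge0 u : 0 <= d u by rewrite divr_ge0 // ltW.
have hn0 u : h u != 0 by rewrite gt_eqF.
(* Where [e u] vanishes the whole row does, so the convention that the inverse of 0 is 0 is harmless
   in the divisions by [e u] and [d u]. *)
have M0 u : e u = 0 -> forall v, M u v = 0.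
  move=> /eqP; rewrite psumr_eq0; last by move=> v _; rewrite mulr_ge0 // ltW.
  move=> /allP z v; have := z v (mem_index_enum _).
  by rewrite /= mulf_eq0 (negPf (hn0 v)) orbF => /eqP.
pose L u v := (u == v)%:R * d u - M u v.
have symL u v : L u v = L v u.
  by rewrite /L symM eq_sym; case: eqP => [->|]; rewrite ?mul0r.
have LE f u : \sum_v L u v * f v = d u * f u - \sum_v M u v * f v.
  under eq_bigr do rewrite mulrBl; rewrite sumrB; congr (_ - _).
  rewrite (bigD1 u) //= eqxx mul1r big1 ?addr0 // => v.
  by rewrite eq_sym => /negPf->; rewrite !mul0r.
have LformE f g : mxform L f g = \sum_u d u * f u * g u - mxform M f g.
  by rewrite /mxform -sumrB; apply: eq_bigr => u _; rewrite LE; ring.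
(* In the coordinate [f / h], [L] is a weighted graph Laplacian: a sum of squares over edges, which
   gives both its positivity and its kernel. *)
have Lsq f : mxform L f f *+ 2 =
    \sum_u \sum_v M u v * (h u * h v * (f u / h u - f v / h v) ^+ 2).
  have T u v : M u v * (h u * h v * (f u / h u - f v / h v) ^+ 2) =
      M u v * h v * (f u ^+ 2 / h u) + M u v * h u * (f v ^+ 2 / h v)
      - M u v * f u * f v *+ 2.
    by field; rewrite !hn0.
  under [RHS]eq_bigr => u _ do under eq_bigr => v _ do rewrite T.
  under [RHS]eq_bigr => u _ do rewrite sumrB big_split /=.
  rewrite sumrB big_split /=.
  have S1 : \sum_u \sum_v M u v * h v * (f u ^+ 2 / h u) = \sum_u d u * f u * f u.
    by apply: eq_bigr => u _; rewrite -mulr_suml -/(e u) /d; ring.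
  have S2 : \sum_u \sum_v M u v * h u * (f v ^+ 2 / h v) = \sum_u d u * f u * f u.
    rewrite exchange_big -S1; apply: eq_bigr => u _; apply: eq_bigr => v _.
    by rewrite symM.
  have S3 : \sum_u \sum_v M u v * f u * f v *+ 2 = mxform M f f *+ 2.
    rewrite -sumrMnl; apply: eq_bigr => u _; rewrite mulr_sumr -sumrMnl.
    by apply: eq_bigr => v _; ring.
  by rewrite S1 S2 S3 LformE; ring.
have term_ge0 f u v : 0 <= M u v * (h u * h v * (f u / h u - f v / h v) ^+ 2).
  by rewrite mulr_ge0 // mulr_ge0 ?sqr_ge0 // mulr_ge0 // ltW.
have Lpsd f : 0 <= mxform L f f.
  by rewrite -(pmulrn_lge0 _ (ltn0Sn 1)) Lsq; do 2!apply: sumr_ge0 => ? _.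
have Lboch f : mxform L f f <= \sum_u (\sum_v L u v * f v) ^+ 2 / d u.
  suff -> : \sum_u (\sum_v L u v * f v) ^+ 2 / d u = 
     \sum_u d u * f u * f u - mxform M f f *+ 2 +
     \sum_u h u * (\sum_v M u v * f v) ^+ 2 / e u.
    by rewrite LformE; have := boch f; rewrite -/(mxform _ _ _) /e; lra.
  rewrite /mxform -sumrMnl -sumrB -big_split; apply: eq_bigr => u _ /=.
  rewrite LE /d; have [e0|en0] := eqVneq (e u) 0.
    rewrite e0 big1 => [|v _]; first by rewrite mul0r invr0; ring.
    by rewrite M0 ?mul0r.
  by field; rewrite hn0 en0.
apply: (@hyperbolic_of_orthogonal M h) => // g gh0.
have [f fE] : exists f, forall u, \sum_v L u v * f v = d u * g u.
  (* A kernel vector [k] is a multiple of [h] wherever [e] is positive, so it pairs with [d g] to a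
     multiple of [mxform M g h = 0]; elsewhere [d] vanishes. *)
  apply: symmetric_solve => // k kL.
  have edge u v : 0 < M u v -> k u / h u = k v / h v.
    move=> Muv.
    have : mxform L k k *+ 2 = 0.
      by rewrite /mxform big1 ?mul0rn // => z _; rewrite kL mulr0.
    rewrite Lsq => /eqP; rewrite psumr_eq0; last by move=> *; apply: sumr_ge0.
    move=> /allP/(_ u (mem_index_enum _)) /=.
    rewrite psumr_eq0 // => /allP/(_ v (mem_index_enum _)) /=.
    rewrite mulf_eq0 gt_eqF //= mulf_eq0 mulf_eq0 !(negPf (hn0 _)) /=.
    by rewrite sqrf_eq0 subr_eq0 => /eqP.
  have cst := conn (fun u => k u / h u) edge.
  have [/existsP[u0 eu0]|/existsPn none] := boolP [exists u, 0 < e u]; last first.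
    apply: big1 => u _; have := none u; rewrite lt0r e_ge0 andbT.
    by move=> /negPn/eqP eu; rewrite /d eu !mul0r.
  rewrite (eq_bigr (fun u => k u0 / h u0 * (g u * e u))).
    by rewrite -mulr_sumr -[X in _ * X]/(mxform M g h) gh0 mulr0.
  move=> u _; have [eu|eun] := eqVneq (e u) 0; first by rewrite /d eu; ring.
  have /= <- := cst u u0 _ eu0; last by rewrite lt0r eun e_ge0.
  by rewrite /d; field.
have gD : \sum_u g u * \sum_v L u v * f v = \sum_u d u * g u * g u.
  by apply: eq_bigr => u _; rewrite fE; ring.
have CS := mxform_cauchy_schwarz g f symL Lpsd.
rewrite [mxform L g f]gD in CS.
have ffle : mxform L f f <= \sum_u d u * g u * g u.
  apply: le_trans (Lboch f) _; apply: ler_sum => u _; rewrite fE.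
  have [d0|dn0] := eqVneq (d u) 0; first by rewrite d0 !mul0r expr0n mul0r.
  by rewrite le_eqVlt; apply/orP; left; apply/eqP; field.
have := Lpsd g; move: CS ffle; have gg := LformE g g; move: gg.
set p := mxform L g g; set q := mxform L f f; set r := \sum_u _; set m := mxform M g g.
move=> pE CS qr p0.
have r0 : 0 <= r.
  by apply: sumr_ge0 => u _; rewrite -mulrA mulr_ge0 // -expr2 sqr_ge0.
have [rz|rn] := eqVneq r 0; first by lra.
have rp : 0 < r by rewrite lt0r rn.
(* Cancelling [r] gives [r <= p], that is, [m = r - p <= 0]. *)
have : r * r <= p * r by rewrite -expr2; apply: le_trans CS _; apply: ler_wpM2l.
by rewrite ler_pM2r //; lra.
Qed.

End Hyperbolic.

(* The contribution [th_u(v) * (th_uv(z) - th(u))] of removing [u], [v], [z] in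
   this order, where [p], [q], [r] are the values of [th] at [u], [v], [z], an
   element unlocked by a removal takes over the value of the removed one, and
   the booleans tell which of [u], [v], [z] are removable in [Q], [Q - u] and
   [Q - u - v].  Individual terms have no sign; the sum over the six orders is
   [0] or a square. *)
Definition pullback_term (R : realFieldType) (p q r : R) (a0 b0 ba c0 ca cab : bool) : R :=
  if [&& a0, ba & cab] then
    let q' := if b0 then q else p in
    q' * ((if ca then if c0 then r else p else q') - p)
  else 0.

(** Here [u0] means that [u] is removable at the start, [uv] after removing [v], and [uvz] after
    removing [v] and [z]. The hypotheses say that removability persists, and that an obstruction to
    [u] survives the removal of [v] or that of [z]. *)
Lemma pullback_term_sum_ge0 (R : realFieldType) (p q r : R)
    (u0 uv uz uvz v0 vu vz vuz z0 zu zv zuv : bool) :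
    (u0 -> uv && uz) -> (uv || uz -> uvz) -> (uv && uz -> u0) ->
    (v0 -> vu && vz) -> (vu || vz -> vuz) -> (vu && vz -> v0) ->
    (z0 -> zu && zv) -> (zu || zv -> zuv) -> (zu && zv -> z0) ->
  0 <= pullback_term p q r u0 v0 vu z0 zu zuv
     + pullback_term p r q u0 z0 zu v0 vu vuz
     + pullback_term q p r v0 u0 uv z0 zv zuv
     + pullback_term q r p v0 z0 zv u0 uv uvz
     + pullback_term r p q z0 u0 uz v0 vz vuz
     + pullback_term r q p z0 v0 vz u0 uz uvz.
Proof.
rewrite /pullback_term.
case: u0 uv uz uvz => [] [] [] [] H1 H2 H3;
  do ?[by have := H1 isT | by have := H2 isT | by have := H3 isT].
all: move: H1 H2 H3 => _ _ _.
all: case: v0 vu vz vuz => [] [] [] [] H1 H2 H3;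
  do ?[by have := H1 isT | by have := H2 isT | by have := H3 isT].
all: move: H1 H2 H3 => _ _ _.
all: case: z0 zu zv zuv => [] [] [] [] H1 H2 H3;
  do ?[by have := H1 isT | by have := H2 isT | by have := H3 isT].
all: move: H1 H2 H3 => _ _ _ /=.
all: have := sqr_ge0 (p - q); have := sqr_ge0 (p - r); have := sqr_ge0 (q - r); nra.
Qed.

(** Permuting the summation variables gives six equal sums; their total is nonnegative term by
    term. *)
Lemma sum3_sym_ge0 (R : realFieldType) (I : finType) (F : I -> I -> I -> R) :
    (forall u v z, 0 <= F u v z + F u z v + F v u z + F v z u + F z u v + F z v u) ->
  0 <= \sum_u \sum_v \sum_z F u v z.
Proof.
move=> F_ge0; set S := \sum_u _.
have S2 : \sum_u \sum_v \sum_z F u z v = S.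
  by apply: eq_bigr => u _; rewrite exchange_big.
have S3 : \sum_u \sum_v \sum_z F v u z = S by rewrite exchange_big.
have S4 : \sum_u \sum_v \sum_z F v z u = S.
  by rewrite exchange_big -S2.
have S5 : \sum_u \sum_v \sum_z F z u v = S.
  rewrite -S3; apply: eq_bigr => u _; rewrite exchange_big.
  by apply: eq_bigr.
have S6 : \sum_u \sum_v \sum_z F z v u = S.
  rewrite -S4; apply: eq_bigr => u _; rewrite exchange_big.
  by apply: eq_bigr.
have : 0 <= S + S + S + S + S + S; last by lra.
rewrite -{2}S2 -{2}S3 -{2}S4 -{2}S5 -{2}S6 {1}/S -!big_split.
apply: sumr_ge0 => u _; rewrite -!big_split.
by apply: sumr_ge0 => v _; rewrite -!big_split; apply: sumr_ge0 => z _; apply: F_ge0.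
Qed.

(** * Removal from below and from above *)

Section Extremal.
Variables (d : Order.disp_t) (T : finPOrderType d).
Implicit Types (Q : {set T}) (u v z : bool * T).

Definition below (s : bool) (x y : T) : bool := if s then (x < y)%O else (y < x)%O.

(* A pair [(s, x)] stands for the removal of [x] from below if [s = true], from
   above if [s = false]. *)
Definition extremal Q u : bool :=
  (u.2 \in Q) && [forall y in Q, ~~ below u.1 y u.2].

Lemma belowxx s x : below s x x = false.
Proof. by case: s; rewrite /= ltxx. Qed.

Lemma below_trans s : transitive (below s).
Proof. by case: s => y x z; [apply: lt_trans | move=> xy yz; apply: lt_trans yz xy]. Qed.

Lemma extremalP Q u :
  reflect (u.2 \in Q /\ forall y, y \in Q -> ~~ below u.1 y u.2) (extremal Q u).
Proof.
apply: (iffP andP) => -[uQ ok]; split=> //; last exact/forall_inP.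
by move=> y; move/forall_inP: ok; apply.
Qed.

Lemma extremal_in Q u : extremal Q u -> u.2 \in Q.
Proof. by case/andP. Qed.

Lemma extremal_D1 Q u x : extremal Q u -> u.2 != x -> extremal (Q :\ x) u.
Proof.
move=> /extremalP[uQ ok] ux; apply/extremalP; split; first by rewrite !inE ux.
by move=> y /setD1P[_ /ok].
Qed.

Lemma extremal_D1_inv Q u x y :
  x != y -> extremal (Q :\ x) u -> extremal (Q :\ y) u -> extremal Q u.
Proof.
move=> xy /extremalP[/setD1P[_ uQ] okx] /extremalP[_ oky].
apply/extremalP; split=> // z zQ; have [zx|zx] := eqVneq z x.
  by apply: oky; rewrite !inE zx xy -zx.
by apply: okx; rewrite !inE zx.
Qed.

Lemma extremal_new_below Q u v :
  extremal (Q :\ u.2) v -> ~~ extremal Q v -> u.2 \in Q -> below v.1 u.2 v.2.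
Proof.
move=> /extremalP[/setD1P[_ vQ] ok] nv uQ; apply/negPn; apply: contra nv => nb.
apply/extremalP; split=> // y yQ; have [->//|yu] := eqVneq y u.2.
by apply: ok; rewrite !inE yu.
Qed.

(** The removal of [u] unlocks [v], so [u] blocked [v]; on opposite sides, [v] would then block [u]
    as well. Hence inheritance preserves functions of the side alone. *)
Lemma extremal_new_side Q u v :
  extremal Q u -> extremal (Q :\ u.2) v -> ~~ extremal Q v -> v.1 = u.1.
Proof.
move=> /extremalP[uQ uok] ve nv; have := extremal_new_below ve nv uQ.
have /uok : v.2 \in Q by case/extremalP: ve => /setD1P[].
by rewrite /below; case: u.1 v.1 => [] [] // /negPf->.
Qed.

Lemma exists_extremal Q s : Q != set0 -> exists2 x, x \in Q & extremal Q (s, x).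
Proof.
case/set0Pn=> x0 x0Q.
(* By transitivity, anything below [x] would have strictly fewer elements below it. *)
have [x xQ xmin] := arg_minnP (fun x => #|[set y in Q | below s y x]|) x0Q.
exists x => //; apply/extremalP; split=> // y yQ; apply/negP => /= yx.
have := xmin y yQ; rewrite leqNgt => /negP; apply; apply: proper_card.
apply/properP; split.
  apply/subsetP => z; rewrite !inE => /andP[-> zy]; exact: below_trans zy yx.
by exists y; rewrite !inE yQ ?yx // belowxx.
Qed.

End Extremal.

(** * The bilinear form of the first two removals *)

Section RemovalForm.
Variables (R : realFieldType) (d : Order.disp_t) (T : finPOrderType d).
Variable w : bool * T -> R.
Implicit Types (Q : {set T}) (u v z : bool * T) (b : bool -> R) (l : seq (bool -> R)).
Implicit Types f g : bool * T -> R.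

(* The length of [l] is meant to be [#|Q|]; its [i]-th entry gives the extra
   factor of the [i]-th removal, depending on the side. *)
Fixpoint removal_weight l Q : R :=
  if l is b :: l' then
    \sum_(u | extremal Q u) b u.1 * w u * removal_weight l' (Q :\ u.2)
  else 1.

(* An element that becomes extremal only after the removal of [u] inherits the
   value at [u]. *)
Definition inherit Q u f v : R := if extremal Q v then f v else f u.

Definition removal_form l Q f g : R :=
  \sum_(u | extremal Q u) w u * f u *
    \sum_(v | extremal (Q :\ u.2) v)
      w v * inherit Q u g v * removal_weight l (Q :\ u.2 :\ v.2).

(** The diagonal collects the removals unlocked by [u], which carry the value at [u]; this
    bookkeeping makes the form symmetric. The test on second components prevents removing one
    element from both sides. *)
Definition removal_mx l Q u v : R :=
  (if [&& extremal Q u, extremal Q v & v.2 != u.2]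
   then w u * w v * removal_weight l (Q :\ u.2 :\ v.2) else 0)
  + (u == v)%:R * (if extremal Q u then
       \sum_(z | extremal (Q :\ u.2) z && ~~ extremal Q z)
         w u * w z * removal_weight l (Q :\ u.2 :\ z.2) else 0).

Lemma setD1C Q (x y : T) : Q :\ x :\ y = Q :\ y :\ x.
Proof. by rewrite !setDDl setUC. Qed.

Lemma removal_mx_sym l Q u v : removal_mx l Q u v = removal_mx l Q v u.
Proof.
rewrite /removal_mx; congr (_ + _); last first.
  by rewrite eq_sym; case: eqP => [->//|]; rewrite !mul0r.
rewrite setD1C (mulrC (w u)) (eq_sym v.2).
by case: (extremal Q u) (extremal Q v) => [] [].
Qed.

Lemma removal_mx_row l Q u g :
  \sum_v removal_mx l Q u v * g v =
  if extremal Q u then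
    w u * \sum_(v | extremal (Q :\ u.2) v)
      w v * inherit Q u g v * removal_weight l (Q :\ u.2 :\ v.2)
  else 0.
Proof.
case: ifPn => ue; last first.
  by rewrite big1 // => v _; rewrite /removal_mx (negPf ue) /= mulr0 addr0 mul0r.
rewrite /removal_mx ue; under eq_bigr do rewrite mulrDl; rewrite big_split /=.
rewrite (bigID (extremal Q) (extremal _)) /= mulrDr; congr (_ + _).
  rewrite mulr_sumr [RHS]big_mkcond; apply: eq_bigr => v _.
  have -> : extremal (Q :\ u.2) v && extremal Q v = extremal Q v && (v.2 != u.2).
    apply/andP/andP => -[]; last by move=> ve vu; split=> //; apply: extremal_D1.
    by move=> /extremal_in/setD1P[].
  by rewrite /inherit; case: (extremal Q v); case: (v.2 != u.2) => /=; ring.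
rewrite (bigD1 u) //= [X in _ + X]big1 => [|v]; last first.
  by rewrite eq_sym => /negPf->; rewrite !mul0r.
rewrite eqxx mul1r addr0 mulr_suml mulr_sumr; apply: eq_bigr => v /andP[_ nv].
by rewrite /inherit (negPf nv); ring.
Qed.

Lemma removal_formE l Q f g : removal_form l Q f g = mxform (removal_mx l Q) f g.
Proof.
rewrite /removal_form /mxform big_mkcond; apply: eq_bigr => u _.
by rewrite removal_mx_row; case: ifP => _; rewrite ?mulr0 //; ring.
Qed.

Lemma inherit_side Q u v b :
  extremal Q u -> extremal (Q :\ u.2) v ->
  inherit Q u (fun z => b z.1) v = b v.1.
Proof.
by move=> ue ve; rewrite /inherit; case: ifPn => // nv; rewrite (extremal_new_side ue ve nv).
Qed.

Lemma inherit_scale Q u v b f :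
  extremal Q u -> extremal (Q :\ u.2) v ->
  inherit Q u (fun z => b z.1 * f z) v = b v.1 * inherit Q u f v.
Proof.
by move=> ue ve; rewrite /inherit; case: ifPn => // nv; rewrite (extremal_new_side ue ve nv).
Qed.

(** Pairing with a function of the side turns the free second removal into an ordinary weighted
    one. *)
Lemma removal_form_side l Q f b :
  removal_form l Q f (fun z => b z.1) =
  \sum_(u | extremal Q u) w u * f u * removal_weight (b :: l) (Q :\ u.2).
Proof.
apply: eq_bigr => u ue; congr (_ * _) => /=; apply: eq_bigr => v ve.
by rewrite inherit_side // (mulrC (w v)).
Qed.

Lemma removal_form_side2 l Q b :
  removal_form l Q (fun z => b z.1) (fun z => b z.1) = removal_weight [:: b, b & l] Q.
Proof.
by rewrite removal_form_side; apply: eq_bigr => u _; rewrite (mulrC (w u)).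
Qed.

(** The rows for [Q] are values of the forms of the smaller posets, which is what the induction on
    hyperbolicity exploits. *)
Lemma removal_mx_row_side b l Q u g :
  \sum_v removal_mx (b :: l) Q u v * g v =
  if extremal Q u then
    w u * removal_form l (Q :\ u.2) (inherit Q u g) (fun z => b z.1)
  else 0.
Proof. by rewrite removal_mx_row removal_form_side. Qed.

Definition pos_body b := (0 < b true) && (0 < b false).

Lemma pos_bodyP b s : pos_body b -> 0 < b s.
Proof. by case/andP; case: s. Qed.

Hypothesis w_gt0 : forall u, 0 < w u.

Lemma removal_weight_ge0 l Q : all pos_body l -> 0 <= removal_weight l Q.
Proof.
elim: l Q => [|b l IH] Q //= /andP[bp lp]; apply: sumr_ge0 => u _.
by rewrite mulr_ge0 ?IH // ltW // mulr_gt0 // pos_bodyP.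
Qed.

Lemma removal_weight_gt0 l Q :
  all pos_body l -> #|Q| = size l -> 0 < removal_weight l Q.
Proof.
elim: l Q => [|b l IH] Q //= /andP[bp lp] cQ.
have [x xQ xe] : exists2 x, x \in Q & extremal Q (true, x).
  by apply: exists_extremal; rewrite -card_gt0 cQ.
have bwp u : 0 < b u.1 * w u by rewrite mulr_gt0 ?pos_bodyP.
rewrite (bigD1 (true, x)) //=; apply: ltr_pwDl.
  rewrite mulr_gt0 //; first exact: (bwp (true, x)).
  by apply: IH => //; move: cQ; rewrite (cardsD1 x Q) xQ => -[].
by apply: sumr_ge0 => u _; rewrite mulr_ge0 ?removal_weight_ge0 // ltW.
Qed.

Lemma removal_mx_ge0 l Q u v : all pos_body l -> 0 <= removal_mx l Q u v.
Proof.
move=> lp; have ww z y : 0 <= w z * w y by rewrite mulr_ge0 // ltW.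
rewrite /removal_mx addr_ge0 //.
  by case: ifP => // _; rewrite mulr_ge0 ?removal_weight_ge0.
rewrite mulr_ge0 ?ler0n //; case: ifP => // _; apply: sumr_ge0 => z _.
by rewrite mulr_ge0 ?removal_weight_ge0.
Qed.

Lemma removal_form_ge0 l Q f g :
    all pos_body l -> (forall u, 0 <= f u) -> (forall u, 0 <= g u) ->
  0 <= removal_form l Q f g.
Proof.
move=> lp f0 g0; rewrite removal_formE; apply: sumr_ge0 => u _; rewrite mulr_ge0 //.
by apply: sumr_ge0 => v _; rewrite mulr_ge0 ?removal_mx_ge0.
Qed.

Lemma removal_mx_gt0 l Q u v :
    all pos_body l -> #|Q| = (size l).+2 ->
    extremal Q u -> extremal Q v -> v.2 != u.2 ->
  0 < removal_mx l Q u v.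
Proof.
move=> lp cQ ue ve vu; rewrite /removal_mx ue ve vu /=.
have -> : (u == v) = false by apply: contraNF vu => /eqP->.
rewrite mul0r addr0 mulr_gt0 ?mulr_gt0 // removal_weight_gt0 //.
move: cQ; rewrite (cardsD1 u.2 Q) (extremal_in ue) => -[].
rewrite (cardsD1 v.2 (Q :\ u.2)) !inE vu (extremal_in ve) => -[].
by [].
Qed.

(** Irreducibility: removals of distinct elements are adjacent. The two removals of one element are
    joined through a minimal element of the rest, still minimal in [Q] because the shared element is
    incomparable to all others. *)
Lemma removal_mx_connected l Q f :
    all pos_body l -> #|Q| = (size l).+2 ->
    (forall u v, 0 < removal_mx l Q u v -> f u = f v) ->
  forall u v, extremal Q u -> extremal Q v -> f u = f v.
Proof.
move=> lp cQ fE u v ue ve; have [vu|vu] := eqVneq v.2 u.2; last first.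
  by apply: fE; apply: removal_mx_gt0.
have [->//|uv] := eqVneq u v.
have [z zQ ze] : exists2 z, z \in Q :\ u.2 & extremal (Q :\ u.2) (true, z).
  apply: exists_extremal; rewrite -card_gt0.
  by move: cQ; rewrite (cardsD1 u.2 Q) (extremal_in ue) add1n => -[->].
have zu : z != u.2 by case/setD1P: zQ.
have zeQ : extremal Q (true, z).
  apply/negPn/negP => nz; have ab := extremal_new_below ze nz (extremal_in ue).
  have sides : u.1 != v.1.
    by apply: contra uv => /eqP uv1; case: u v uv1 vu {ue ve ze ab zu zQ} => ? ? [? ?] /= -> ->.
  have zQ' : z \in Q by case/setD1P: zQ.
  case/extremalP: ue => _ /(_ z zQ') uz; case/extremalP: ve => _ /(_ z zQ').
  move: uz ab sides; rewrite vu /below.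
  by case: u.1 v.1 => [] [] //= ; case: (u.2 < z)%O.
transitivity (f (true, z)); first by apply: fE; apply: removal_mx_gt0.
by apply: fE; apply: removal_mx_gt0 => //=; rewrite vu eq_sym.
Qed.

(** Both sides expand over triples of successive removals. Their difference is a weight symmetric in
    the triple times [pullback_term], so the six orders can be grouped. *)
Lemma removal_form_pullback b l Q f :
    pos_body b -> all pos_body l ->
  removal_form (b :: l) Q f f <=
  \sum_(u | extremal Q u)
    b u.1 * w u * removal_form l (Q :\ u.2) (inherit Q u f) (inherit Q u f).
Proof.
move=> bp lp; have bn0 s : b s != 0 by rewrite gt_eqF ?pos_bodyP.
(* Dividing out the side factor is what makes the weight [G] symmetric in the three removals. *)
pose t u := f u / b u.1.
pose G u v z := w u * w v * w z * (b u.1 * b v.1 * b z.1) *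
  removal_weight l (Q :\ u.2 :\ v.2 :\ z.2).
pose F u v z := G u v z * pullback_term (t u) (t v) (t z)
  (extremal Q u) (extremal Q v) (extremal (Q :\ u.2) v)
  (extremal Q z) (extremal (Q :\ u.2) z) (extremal (Q :\ u.2 :\ v.2) z).
rewrite -subr_ge0 -sumrB.
suff -> : \sum_(u | extremal Q u)
    (b u.1 * w u * removal_form l (Q :\ u.2) (inherit Q u f) (inherit Q u f) -
     w u * f u * \sum_(v | extremal (Q :\ u.2) v) w v * inherit Q u f v *
        removal_weight (b :: l) (Q :\ u.2 :\ v.2))
   = \sum_u \sum_v \sum_z F u v z.
  apply: sum3_sym_ge0 => u v z.
  have G_ge0 : 0 <= G u v z.
    by rewrite mulr_ge0 ?removal_weight_ge0 // ltW // !mulr_gt0 ?pos_bodyP.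
  have G2 : G u z v = G u v z by rewrite /G setD1C; ring.
  have G3 : G v u z = G u v z by rewrite /G (setD1C Q v.2); ring.
  have G4 : G v z u = G u v z by rewrite -G3 /G setD1C; ring.
  have G5 : G z u v = G u v z by rewrite -G2 /G (setD1C Q z.2); ring.
  have G6 : G z v u = G u v z by rewrite -G4 /G (setD1C Q z.2); ring.
  have Fdiag x y y' : (x.2 == y.2) || (x.2 == y'.2) || (y.2 == y'.2) -> F x y y' = 0.
    move=> same; rewrite /F /pullback_term; case: ifP => [|_]; last by rewrite mulr0.
    case/and3P=> _ /extremal_in/setD1P[yx _] /extremal_in/setD1P[zy /setD1P[zx _]].
    by move: same; rewrite eq_sym (negPf yx) (eq_sym x.2) (negPf zx) eq_sym (negPf zy).
  have [uv|uv] := eqVneq u.2 v.2.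
    by rewrite !Fdiag ?uv ?eqxx ?orbT // !addr0.
  have [uz|uz] := eqVneq u.2 z.2.
    by rewrite !Fdiag ?uz ?eqxx ?orbT // !addr0.
  have [vz|vz] := eqVneq v.2 z.2.
    by rewrite !Fdiag ?vz ?eqxx ?orbT // !addr0.
  rewrite /F G2 G3 G4 G5 G6 -!mulrDr mulr_ge0 //.
  rewrite (setD1C Q v.2 u.2) (setD1C Q z.2 u.2) (setD1C Q z.2 v.2).
  apply: pullback_term_sum_ge0.
  - by move=> ue; rewrite !extremal_D1.
  - by case/orP => ue; [|rewrite setD1C]; apply: extremal_D1.
  - by case/andP; apply: extremal_D1_inv.
  - by move=> ue; rewrite !extremal_D1 // eq_sym.
  - by case/orP => ue; [|rewrite setD1C]; apply: extremal_D1 => //; rewrite eq_sym.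
  - by case/andP; apply: extremal_D1_inv.
  - by move=> ue; rewrite !extremal_D1 // eq_sym.
  - by case/orP => ue; [|rewrite setD1C]; apply: extremal_D1; rewrite // eq_sym.
  - by case/andP; apply: extremal_D1_inv.
have fE : f =1 (fun u => b u.1 * t u) by move=> u; rewrite /t; field.
rewrite big_mkcond; apply: eq_bigr => u _; case: ifPn => ue; last first.
  by rewrite big1 // => v _; rewrite big1 // => z _; rewrite /F /pullback_term (negPf ue) mulr0.
rewrite /removal_form !mulr_sumr -sumrB big_mkcond; apply: eq_bigr => v _.
case: ifPn => ve; last first.
  by rewrite big1 // => z _; rewrite /F /pullback_term (negPf ve) andbF mulr0.
rewrite /= !mulr_sumr -sumrB big_mkcond; apply: eq_bigr => z _.
case: ifPn => ze; last first.
  by rewrite /F /pullback_term (negPf ze) !andbF mulr0.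
rewrite /F /pullback_term ue ve ze /=.
have inhE x : inherit Q u f x = inherit Q u (fun u => b u.1 * t u) x.
  by rewrite /inherit !fE.
have inh1 : inherit Q u f v = b v.1 * inherit Q u t v.
  by rewrite inhE inherit_scale.
have inh2 : inherit (Q :\ u.2) v (inherit Q u f) z =
    b z.1 * inherit (Q :\ u.2) v (inherit Q u t) z.
  rewrite /inherit -/(inherit Q u f z) -/(inherit Q u f v) -/(inherit Q u t z) -/(inherit Q u t v).
  case: ifPn => nz; first by rewrite inhE inherit_scale.
  by rewrite inh1 (extremal_new_side ve ze nz).
rewrite -[RHS]/(G u v z *
  (inherit Q u t v * (inherit (Q :\ u.2) v (inherit Q u t) z - t u))).
by rewrite inh1 inh2 (fE u) /G; ring.
Qed.

End RemovalForm.

(** * Hyperbolicity of the removal form *)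

Section RemovalHyperbolic.
Variables (R : realFieldType) (d : Order.disp_t) (T : finPOrderType d).
Variable w : bool * T -> R.
Implicit Types (Q : {set T}) (u v z : bool * T) (b : bool -> R) (l : seq (bool -> R)).
Implicit Types f g : bool * T -> R.
Hypothesis w_gt0 : forall u, 0 < w u.
(** For a two-element chain this makes the determinant of the form nonpositive. *)
Hypothesis w_cross : forall x y : T, (x < y)%O ->
  w (true, y) * w (false, x) <= w (true, x) * w (false, y).

Lemma removal_form_set2 (x y : T) f g : x != y ->
  let Q := [set x; y] in
  let half x y := \sum_s (if below s y x then 0 else w (s, x) * f (s, x) *
    \sum_s' w (s', y) * (if below s' x y then g (s, x) else g (s', y))) in
  removal_form w [::] Q f g = half x y + half y x.
Proof.
move=> xy Q half.
have ext2 s x' y' : x' != y' -> extremal [set x'; y'] (s, x') = ~~ below s y' x'.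
  move=> xy'; apply/extremalP/idP => /= [[_ ok]|ok]; first by apply: ok; rewrite !inE eqxx orbT.
  by split=> [|z]; rewrite !inE ?eqxx // => /orP[]/eqP->; rewrite ?belowxx.
have ext1 s x' : extremal [set x'] (s, x').
  by apply/extremalP; split=> [|z]; rewrite inE ?eqxx // => /eqP->; rewrite belowxx.
have sumE (Q' : {set T}) (F : bool * T -> R) :
    \sum_(u | extremal Q' u) F u =
    \sum_(x in Q') \sum_s if extremal Q' (s, x) then F (s, x) else 0.
  rewrite exchange_big pair_big_dep big_mkcond [RHS]big_mkcond /=; apply: eq_bigr.
  by move=> -[s x'] _ /=; case: ifPn => [/extremal_in /= ->//|_]; case: ifP.
have yx : y != x by rewrite eq_sym.
have QC : Q = [set y; x] by rewrite /Q setUC.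
have Qx : Q :\ x = [set y] by apply/setP => z; rewrite !inE; case: eqVneq => // ->; rewrite (negPf xy).
have Qy : Q :\ y = [set x] by apply/setP => z; rewrite !inE; case: eqVneq => [->|]; rewrite ?(negPf yx) ?orbF.
rewrite /removal_form sumE /Q big_setU1 ?inE //= big_set1 -/Q; congr (_ + _).
- apply: eq_bigr => s _; rewrite /Q ext2 // if_neg -/Q; case: ifP => // _; congr (_ * _).
  rewrite Qx sumE big_set1; apply: eq_bigr => s' _; rewrite ext1 mulr1 /inherit.
  by rewrite QC ext2 // if_neg.
- apply: eq_bigr => s _; rewrite QC ext2 // if_neg -QC; case: ifP => // _; congr (_ * _).
  rewrite Qy sumE big_set1; apply: eq_bigr => s' _; rewrite ext1 mulr1 /inherit.
  by rewrite /Q ext2 // if_neg.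
Qed.

Lemma removal_form_hyperbolic2 Q : #|Q| = 2%N -> hyperbolic (removal_form w [::] Q).
Proof.
move=> /eqP/cards2P[x [y [xy ->]]].
wlog yx : x y xy / ~~ (y < x)%O.
  move=> gen; have [lt_yx|] := boolP (y < x)%O; last exact: gen.
  by rewrite setUC; apply: gen; rewrite 1?eq_sym // lt_gtF.
move=> f g _; rewrite !removal_form_set2 // !big_bool /= !(negPf yx).
have [lt_xy|_] := boolP (x < y)%O; last first.
  rewrite -subr_ge0.
  (* Antichain: the form is a symmetrized product of two linear functionals, one per element, so the
     discriminant is a square. *)
  set F := w (true, x) * f (true, x); set F' := w (false, x) * f (false, x).
  set G := w (true, x) * g (true, x); set G' := w (false, x) * g (false, x).
  set H := w (true, y) * f (true, y); set H' := w (false, y) * f (false, y).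
  set K := w (true, y) * g (true, y); set K' := w (false, y) * g (false, y).
  by rewrite (_ : _ - _ = ((F + F') * (K + K') - (G + G') * (H + H')) ^+ 2)
    ?sqr_ge0 //; ring.
rewrite -subr_ge0; have := w_cross lt_xy.
have := w_gt0 (true, x); have := w_gt0 (false, y).
set a := w (true, x); set a' := w (false, x); set c := w (true, y); set c' := w (false, y).
set p := f (true, x); set q := f (false, y); set r := g (true, x); set t := g (false, y).
move=> c'p ap cross.
(* Chain: only [(true, x)] and [(false, y)] are extremal. The matrix has diagonal [a * c], [a' * c']
   and off-diagonal entry [a * c']. *)
rewrite (_ : _ - _ = (a * c') * (a * c' - c * a') * (p * t - q * r) ^+ 2); last by ring.
by rewrite mulr_ge0 ?sqr_ge0 // mulr_ge0 ?subr_ge0 // mulr_ge0 // ltW.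
Qed.

Theorem removal_form_hyperbolic l Q :
  all (@pos_body R) l -> #|Q| = (size l).+2 -> hyperbolic (removal_form w l Q).
Proof.
elim: l Q => [|b l IH] Q; first by move=> _; apply: removal_form_hyperbolic2.
move=> blp cQ; have /andP[bp lp] : pos_body b && all (@pos_body R) l := blp.
suff H : hyperbolic (mxform (removal_mx w (b :: l) Q)).
  by move=> f g; rewrite !removal_formE; apply: H.
pose h u := b u.1.
have cD u : extremal Q u -> #|Q :\ u.2| = (size l).+2.
  by move=> ue; move: cQ; rewrite (cardsD1 u.2 Q) (extremal_in ue) => -[].
have rowh u : \sum_v removal_mx w (b :: l) Q u v * h v =
    if extremal Q u then w u * removal_weight w [:: b, b & l] (Q :\ u.2) else 0.
  rewrite removal_mx_row; case: ifP => // ue; congr (_ * _).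
  by apply: eq_bigr => v ve; rewrite inherit_side // (mulrC (w v)).
have rowh_gt0 u : extremal Q u -> 0 < removal_weight w [:: b, b & l] (Q :\ u.2).
  by move=> ue; apply: removal_weight_gt0; rewrite ?cD //= bp.
apply: (@hyperbolic_bochner _ _ _ h).
- by move=> u v; apply: removal_mx_sym.
- by move=> u v; apply: removal_mx_ge0.
- by move=> u; apply: pos_bodyP.
- move=> f fE u v; rewrite !rowh; case: ifPn => ue; last by rewrite ltxx.
  case: ifPn => ve; last by rewrite ltxx.
  by move=> _ _; apply: (removal_mx_connected w_gt0 blp cQ fE).
- move=> f; rewrite -removal_formE.
  (* After the pullback, the induction hypothesis for each [Q :\ u.2], taken against the side
     function, yields the Bochner quotient. *)
  apply: le_trans (removal_form_pullback w_gt0 Q f bp lp) _.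
  rewrite big_mkcond; apply: ler_sum => u _; rewrite rowh.
  case: ifPn => ue; last by rewrite invr0 mulr0.
  rewrite removal_mx_row_side ue.
  have Bh := removal_form_side2 w l (Q :\ u.2) b.
  have Np := rowh_gt0 u ue; rewrite -Bh in Np *.
  have := IH _ lp (cD u ue) (inherit Q u f) (fun z => b z.1) Np.
  move: Np; set B1 := removal_form _ _ _ _ _; set B2 := removal_form _ _ _ _ _.
  set B3 := removal_form _ _ _ _ _ => Np B123.
  have wn0 : w u != 0 by rewrite gt_eqF.
  have -> : h u * (w u * B3) ^+ 2 / (w u * B1) = b u.1 * w u * (B3 ^+ 2 / B1).
    by rewrite /h; field; rewrite wn0 gt_eqF.
  rewrite ler_wpM2l ?ler_pdivlMr //.
  by rewrite mulr_ge0 // ltW // pos_bodyP.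
Qed.

Theorem removal_weight_ineq b l Q s (x y : T) :
    pos_body b -> all (@pos_body R) l -> #|Q| = (size l).+2 -> x != y ->
    extremal Q (s, x) -> extremal Q (s, y) ->
  removal_weight w [:: b, b & l] Q * removal_weight w l (Q :\ x :\ y) <=
  2 * (removal_weight w (b :: l) (Q :\ x) * removal_weight w (b :: l) (Q :\ y)).
Proof.
move=> bp lp cQ xy xe ye.
pose u := (s, x); pose v := (s, y).
have uv : (u == v) = false by apply: contraNF xy => /eqP[->].
pose du z : R := (z == u)%:R; pose dv z : R := (z == v)%:R.
have blp : all (@pos_body R) (b :: l) by rewrite /= bp.
set A := removal_weight w [:: b, b & l] Q.
set D := removal_weight w l _; set X := removal_weight w _ (Q :\ x).
set Y := removal_weight w _ (Q :\ y).
have cD (t : T) : t \in Q -> #|Q :\ t| = (size l).+1.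
  by move=> tQ; move: cQ; rewrite (cardsD1 t Q) tQ => -[].
have X_gt0 : 0 < X by rewrite removal_weight_gt0 ?cD // (extremal_in xe).
have Y_gt0 : 0 < Y by rewrite removal_weight_gt0 ?cD // (extremal_in ye).
have A_gt0 : 0 < A by rewrite removal_weight_gt0 //= bp.
have ddiag z f : extremal Q z -> removal_form w l Q (fun z' => (z' == z)%:R) f =
    w z * \sum_(v | extremal (Q :\ z.2) v)
      w v * inherit Q z f v * removal_weight w l (Q :\ z.2 :\ v.2).
  move=> ze; rewrite /removal_form (bigD1 z) //= eqxx mulr1 [X in _ + X]big1 ?addr0 //.
  by move=> z' /andP[_ /negPf->]; rewrite mulr0 mul0r.
have Bu : removal_form w l Q du (fun z => b z.1) = w u * X.
  by rewrite ddiag //; congr (_ * _); apply: eq_bigr => z ze; rewrite inherit_side // (mulrC (w z)).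
have Bv : removal_form w l Q dv (fun z => b z.1) = w v * Y.
  by rewrite ddiag //; congr (_ * _); apply: eq_bigr => z ze; rewrite inherit_side // (mulrC (w z)).
have Buv : removal_form w l Q du dv = w u * w v * D.
  rewrite ddiag // (bigD1 v) /=; last by apply: extremal_D1; rewrite //= eq_sym.
  rewrite big1 => [|z /andP[_ zv]]; last first.
    by rewrite /inherit /dv (negPf zv) uv; case: ifP; rewrite mulr0 mul0r.
  by rewrite /inherit ye /dv eqxx addr0 mulr1 mulrA.
have d_ge0 z z' : 0 <= (z == z')%:R :> R by rewrite ler0n.
have Buu : 0 <= removal_form w l Q du du by apply: removal_form_ge0.
have Bvv : 0 <= removal_form w l Q dv dv by apply: removal_form_ge0.
have AE : A = removal_form w l Q (fun z => b z.1) (fun z => b z.1).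
  by rewrite removal_form_side2.
(* The coefficients are balanced so that both coordinate vectors contribute equally to the pairing
   with the side function. *)
pose f z := (w v * Y) * du z + (w u * X) * dv z.
have sym := removal_mx_sym w l Q.
have := removal_form_hyperbolic lp cQ f (g := fun z => b z.1).
rewrite -AE => /(_ A_gt0).
rewrite !removal_formE mxform_comb // -!removal_formE.
have -> : removal_form w l Q f (fun z => b z.1) = 2 * (w u * X * (w v * Y)).
  rewrite removal_formE mxformC // mxform_linr !(mxformC (fun z => b z.1)) //.
  by rewrite -!removal_formE Bu Bv; ring.
rewrite Buv.
move: Buu Bvv; set p := removal_form _ _ _ _ _; set q := removal_form _ _ _ _ _.
move=> p0 q0 H.
set c := w u * w v; have cp : 0 < c by rewrite mulr_gt0.
(* Once the diagonal terms [p] and [q] are dropped, this common factor cancels, and with it the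
   weights of [u] and [v]. *)
have XY : 0 < c ^+ 2 * (X * Y) * 2 by rewrite !mulr_gt0.
rewrite -(ler_pM2l XY); apply: le_trans (_ : _ <= (2 * (w u * X * (w v * Y))) ^+ 2) _.
  apply: le_trans H; rewrite -subr_ge0.
  rewrite (_ : _ - _ = ((w v * Y) ^+ 2 * p + (w u * X) ^+ 2 * q) * A); last by rewrite /c; ring.
  by rewrite mulr_ge0 ?(ltW A_gt0) // addr_ge0 // mulr_ge0 // sqr_ge0.
by rewrite le_eqVlt /c; apply/orP; left; apply/eqP; ring.
Qed.

End RemovalHyperbolic.

(** * Degeneration of the weights *)

Section SmallWeights.
Variables (R : realFieldType) (d : Order.disp_t) (T : finPOrderType d) (a : T).
Implicit Types (e : R) (s : bool) (ls : seq bool) (Q : {set T}).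

Definition eps_weight e (u : bool * T) : R := if below u.1 a u.2 then e else 1.
Definition eps_body e s : bool -> R := fun s' => if s' == s then 1 else e.
Definition eps_removal e ls Q : R :=
  removal_weight (eps_weight e) (map (eps_body e) ls) Q.

Lemma eps_weight_gt0 e u : 0 < e -> 0 < eps_weight e u.
Proof. by rewrite /eps_weight; case: ifP. Qed.

(** If [x < y] and [x] may not be removed from below, neither may [y]; dually from above. *)
Lemma eps_weight_cross e (x y : T) : 0 < e <= 1 -> (x < y)%O ->
  eps_weight e (true, y) * eps_weight e (false, x) <=
  eps_weight e (true, x) * eps_weight e (false, y).
Proof.
move=> /andP[e0 e1] xy; rewrite /eps_weight /=; apply: ler_pM.
- by case: ifP => // _; apply: ltW.
- by case: ifP => // _; apply: ltW.
- have [ax|_] := boolP (a < x)%O; first by rewrite (lt_trans ax xy).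
  by case: ifP.
- have [ya|_] := boolP (y < a)%O; first by rewrite (lt_trans xy ya).
  by case: ifP.
Qed.

Lemma pos_eps_body e s : 0 < e -> pos_body (eps_body e s).
Proof. by move=> e0; rewrite /pos_body /eps_body; case: s; rewrite /= e0 ltr01. Qed.

Lemma all_pos_eps_body e ls : 0 < e -> all (@pos_body R) (map (eps_body e) ls).
Proof. by move=> e0; elim: ls => //= s ls ->; rewrite pos_eps_body. Qed.

(** The weight is a polynomial in [e] with nonnegative coefficients, hence monotone and Lipschitz on
    the unit interval. *)
Lemma eps_removal_bounds ls : exists2 C : R, 0 <= C &
  forall Q e, 0 <= e <= 1 ->
    eps_removal 0 ls Q <= eps_removal e ls Q <= eps_removal 0 ls Q + e * C.
Proof.
suff [C C0 H] : exists2 C : R, 0 <= C & forall Q e, 0 <= e <= 1 ->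
    [/\ 0 <= eps_removal e ls Q, eps_removal e ls Q <= C,
      eps_removal 0 ls Q <= eps_removal e ls Q
      & eps_removal e ls Q <= eps_removal 0 ls Q + e * C].
  by exists C => // Q e e01; have [_ _ -> ->] := H Q e e01.
elim: ls => [|s ls [C C0 IH]].
  by exists 1; rewrite ?ler01 // => Q e /andP[e0 _]; rewrite /eps_removal /= mulr1 lerDl lexx ler01.
have z01 : 0 <= (0 : R) <= 1 by rewrite lexx ler01.
have K0 : 0 <= \sum_(u : bool * T) (C + C) by apply: sumr_ge0 => u _; rewrite addr_ge0.
(* One [C] pays for the change of the first factor, the other for that of the remaining weight.
   Summing over all [u] keeps the constant independent of [Q]. *)
exists (\sum_(u : bool * T) (C + C)) => // Q e e01; case/andP: (e01) => e0 e1.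
rewrite /eps_removal /=.
pose c e' u := eps_body e' s u.1 * eps_weight e' u.
have c_ge0 u : 0 <= c e u.
  by rewrite /c /eps_body /eps_weight mulr_ge0 //; case: ifP.
have c_le1 u : c e u <= 1.
  by rewrite /c /eps_body /eps_weight; do 2?case: ifP => _; nra.
have c0_ge0 u : 0 <= c 0 u by rewrite /c /eps_body /eps_weight mulr_ge0 //; case: ifP.
have c0_le u : c 0 u <= c e u.
  by rewrite /c /eps_body /eps_weight; do 2?case: ifP => _; nra.
have c_le u : c e u <= c 0 u + e.
  by rewrite /c /eps_body /eps_weight; do 2?case: ifP => _; nra.
have step u : [/\ 0 <= c e u * eps_removal e ls (Q :\ u.2),
    c e u * eps_removal e ls (Q :\ u.2) <= C + C,
    c 0 u * eps_removal 0 ls (Q :\ u.2) <= c e u * eps_removal e ls (Q :\ u.2) &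
    c e u * eps_removal e ls (Q :\ u.2) <=
      c 0 u * eps_removal 0 ls (Q :\ u.2) + e * (C + C)].
  have [n0 nC lo up] := IH (Q :\ u.2) e e01.
  have [m0 _ _ _] := IH (Q :\ u.2) 0 z01.
  move: (c_ge0 u) (c_le1 u) (c0_ge0 u) (c0_le u) (c_le u) n0 nC lo up m0.
  set x := c e u; set x0 := c 0 u; set n := eps_removal e _ _; set m := eps_removal 0 _ _.
  move=> x_ge0 x_le1 x0_ge0 x0x xx0 n0 nC mn up m0.
  have A1 : x * n <= 1 * n by rewrite ler_wpM2r.
  have A2 : x * n <= (x0 + e) * n by rewrite ler_wpM2r.
  have A3 : x0 * n <= x0 * (m + e * C) by rewrite ler_wpM2l.
  have A4 : x0 * (e * C) <= 1 * (e * C) by rewrite ler_wpM2r ?mulr_ge0 //; lra.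
  have A5 : e * n <= e * C by rewrite ler_wpM2l.
  split; [exact: mulr_ge0 | lra | exact: ler_pM | lra].
split.
- by apply: sumr_ge0 => u _; case: (step u).
- rewrite big_mkcond; apply: ler_sum => u _; case: ifP => _; first by case: (step u).
  by rewrite addr_ge0.
- by apply: ler_sum => u _; case: (step u).
- apply: (@le_trans _ _ (\sum_(u | extremal Q u)
    (c 0 u * eps_removal 0 ls (Q :\ u.2) + e * (C + C)))).
    by apply: ler_sum => u _; case: (step u).
  rewrite big_split lerD2l mulr_sumr big_mkcond; apply: ler_sum => u _.
  by case: ifP => // _; rewrite mulr_ge0 ?addr_ge0.
Qed.

Lemma eps_removal0_cons s ls Q :
  eps_removal 0 (s :: ls) Q =
  \sum_(x | extremal Q (s, x) && ~~ below s a x) eps_removal 0 ls (Q :\ x).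
Proof.
rewrite /eps_removal /= (bigID (fun u => (u.1 == s) && ~~ below u.1 a u.2)) /=.
rewrite [X in _ + X]big1 ?addr0 => [|u /andP[_]]; last first.
  rewrite /eps_body /eps_weight; case: eqP => /= _; last by rewrite !mul0r.
  by move=> /negPn->; rewrite mulr0 mul0r.
rewrite [LHS]big_mkcond [RHS]big_mkcond /=.
rewrite -(pair_bigA _ (fun s' x => if extremal Q (s', x) && ((s' == s) && ~~ below s' a x)
  then eps_body 0 s s' * eps_weight 0 (s', x) *
    removal_weight (eps_weight 0) (map (eps_body 0) ls) (Q :\ x) else 0)) /=.
rewrite (bigD1 s) //= [X in _ + X]big1 ?addr0 => [|s' /negPf s's]; last first.
  by apply: big1 => x _; rewrite s's andbF.
apply: eq_bigr => x _; rewrite eqxx /=; case: ifP => // /andP[_ nb].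
by rewrite /eps_body /eps_weight eqxx /= (negPf nb) !mul1r.
Qed.

Theorem eps_removal0_ineq s ls Q s' (x y : T) :
    #|Q| = (size ls).+2 -> x != y -> extremal Q (s', x) -> extremal Q (s', y) ->
  eps_removal 0 [:: s, s & ls] Q * eps_removal 0 ls (Q :\ x :\ y) <=
  2 * (eps_removal 0 (s :: ls) (Q :\ x) * eps_removal 0 (s :: ls) (Q :\ y)).
Proof.
move=> cQ xy xe ye.
have [C1 C1p H1] := eps_removal_bounds [:: s, s & ls].
have [C2 C2p H2] := eps_removal_bounds ls.
have [C C0 H] := eps_removal_bounds (s :: ls).
have ineq e : 0 < e <= 1 ->
  eps_removal e [:: s, s & ls] Q * eps_removal e ls (Q :\ x :\ y) <=
  2 * (eps_removal e (s :: ls) (Q :\ x) * eps_removal e (s :: ls) (Q :\ y)).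
  move=> e01; have /andP[e0 e1] := e01; apply: removal_weight_ineq xe ye => //.
  - by move=> u; apply: eps_weight_gt0.
  - by move=> x' y'; apply: eps_weight_cross.
  - exact: pos_eps_body.
  - exact: all_pos_eps_body.
  - by rewrite size_map.
have ge0 ls' Q' : 0 <= eps_removal 0 ls' Q'.
  elim: ls' Q' => [|t ls' IH] Q'; first by rewrite /eps_removal /= ler01.
  by rewrite eps_removal0_cons; apply: sumr_ge0.
set A := eps_removal _ _ Q; set D := eps_removal _ _ (_ :\ _ :\ _).
set X := eps_removal _ _ (Q :\ x); set Y := eps_removal _ _ (Q :\ y).
have [X0 Y0] : 0 <= X /\ 0 <= Y by split; apply: ge0.
have bound e : 0 < e <= 1 -> A * D <= 2 * (X * Y) + e * (2 * (C * Y + C * X + C * C)).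
  move=> e01; have /andP[e0 e1] := e01.
  have e01' : 0 <= e <= 1 by rewrite ltW.
  have /andP[A1 _] := H1 Q e e01'; have /andP[D1 _] := H2 (Q :\ x :\ y) e e01'.
  have /andP[Xl Xu] := H (Q :\ x) e e01'; have /andP[Yl Yu] := H (Q :\ y) e e01'.
  have := ineq e e01; move: A1 D1 Xl Xu Yl Yu; rewrite -/A -/D -/X -/Y.
  set A' := eps_removal e _ Q; set D' := eps_removal e _ (_ :\ _ :\ _).
  set X' := eps_removal e _ (Q :\ x); set Y' := eps_removal e _ (Q :\ y).
  move=> A1 D1 Xl Xu Yl Yu main.
  have AD : A * D <= A' * D' by apply: ler_pM; rewrite // ge0.
  have XY : X' * Y' <= (X + e * C) * (Y + e * C).
    by apply: ler_pM => //; [apply: le_trans Xl | apply: le_trans Yl].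
  have ee : e * e * (C * C) <= e * (C * C).
    by rewrite -mulrA ler_wpM2l ?(ltW e0) // ler_piMl // mulr_ge0.
  have XYE : (X + e * C) * (Y + e * C) =
    X * Y + e * (C * Y + C * X) + e * e * (C * C) by ring.
  by rewrite XYE in XY; lra.
rewrite leNgt; apply/negP => lt.
set E := 2 * (C * Y + C * X + C * C) in bound.
have E0 : 0 <= E by rewrite mulr_ge0 // !addr_ge0 ?mulr_ge0.
pose del := A * D - 2 * (X * Y); have delp : 0 < del by rewrite subr_gt0.
have dE : 0 < del + E by lra.
(* This [e] lies in the allowed range, and the bound at it reads [del + E <= E], contradicting
   [del > 0]. *)
have := bound (del / (del + E)); rewrite divr_gt0 // ler_pdivrMr // mul1r lerDl E0.
move=> /(_ isT); rewrite -lerBlDl -/del mulrAC ler_pdivlMr // ler_pM2l //.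
by lra.
Qed.

End SmallWeights.

(** * Linear extensions as tuples *)

Local Close Scope ring_scope.

Section Tuples.
Variables (d : Order.disp_t) (T : finPOrderType d).
Implicit Types (A Q : {set T}) (a x : T) (s : seq T).

Definition linext_seq A s : bool :=
  [&& uniq s, [forall x, (x \in s) == (x \in A)]
    & pairwise (fun u v => ~~ (v < u)%O) s].

(* Positions are counted from [0] here, whereas [linext_count] counts from [1]. *)
Definition linext_tuples a k n A : nat :=
  #|[set t : n.-tuple T | linext_seq A t && (index a t == k)]|.

Lemma linext_seq_mem A s : linext_seq A s -> s =i A.
Proof. by case/and3P => _ /forallP sA _ x; apply/eqP. Qed.

Lemma linext_seq_cons A x s :
  linext_seq A (x :: s) =
  [&& x \in A, [forall y in A, ~~ (y < x)%O] & linext_seq (A :\ x) s].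
Proof.
apply/idP/idP.
  move=> xs; have mem := linext_seq_mem xs; case/and3P: xs => /= /andP[xs us] _ /andP[allx ps].
  rewrite -mem mem_head /=; apply/andP; split.
    apply/forall_inP => y; rewrite -mem inE => /predU1P[->|ys]; first by rewrite ltxx.
    by move/allP: allx; apply.
  rewrite /linext_seq us ps andbT; apply/forallP => y; rewrite !inE -mem inE.
  by case: (eqVneq y x) => [->|//]; rewrite (negPf xs).
case/and3P=> xA /forall_inP xmin xs; have mem := linext_seq_mem xs.
case/and3P: xs => us _ ps; rewrite /linext_seq /= us ps mem !inE eqxx /= andbT.
apply/andP; split; last first.
  by apply/allP => y; rewrite mem => /setD1P[_ /xmin].
by apply/forallP => y; rewrite inE mem !inE; case: (eqVneq y x) => [->|//]; rewrite xA.
Qed.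

Lemma linext_seq_rcons A x s :
  linext_seq A (rcons s x) =
  [&& x \in A, [forall y in A, ~~ (x < y)%O] & linext_seq (A :\ x) s].
Proof.
have memr : rcons s x =i x :: s by move=> y; rewrite mem_rcons.
apply/idP/idP.
  move=> xs; have mem := linext_seq_mem xs; case/and3P: xs.
  rewrite rcons_uniq pairwise_rcons => /andP[xs us] _ /andP[allx ps].
  rewrite -mem memr mem_head /=; apply/andP; split.
    apply/forall_inP => y; rewrite -mem memr inE => /predU1P[->|ys]; first by rewrite ltxx.
    by move/allP: allx; apply.
  rewrite /linext_seq us ps andbT; apply/forallP => y; rewrite !inE -mem memr inE.
  by case: (eqVneq y x) => [->|//]; rewrite (negPf xs).
case/and3P=> xA /forall_inP xmax xs; have mem := linext_seq_mem xs.
case/and3P: xs => us _ ps.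
rewrite /linext_seq rcons_uniq pairwise_rcons us ps mem !inE eqxx /= andbT.
apply/andP; split; last first.
  by apply/allP => y; rewrite mem => /setD1P[_ /xmax].
by apply/forallP => y; rewrite memr inE mem !inE; case: (eqVneq y x) => [->|//]; rewrite xA.
Qed.

Lemma card_tuple_cons n (P : pred (seq T)) :
  #|[set t : n.+1.-tuple T | P t]| = \sum_x #|[set t : n.-tuple T | P (x :: t)]|.
Proof.
rewrite -sum1dep_card (reindex (fun p : T * n.-tuple T => [tuple of p.1 :: p.2])) /=.
  under [RHS]eq_bigr do rewrite -sum1dep_card.
  by rewrite pair_big_dep /=; apply: eq_bigl.
exists (fun t : n.+1.-tuple T => (thead t, [tuple of behead t])) => [[x t] _|t _] /=.
  by congr (_, _); apply: val_inj.
by case/tupleP: t => x t; apply: val_inj.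
Qed.

Lemma card_tuple_rcons n (P : pred (seq T)) :
  #|[set t : n.+1.-tuple T | P t]| = \sum_x #|[set t : n.-tuple T | P (rcons t x)]|.
Proof.
have revK' m : involutive (fun t : m.-tuple T => [tuple of rev t]).
  by move=> t; apply: val_inj; rewrite /= revK.
have card_rev m (P' : pred (seq T)) :
    #|[set t : m.-tuple T | P' t]| = #|[set t : m.-tuple T | P' (rev t)]|.
  rewrite -!sum1dep_card (reindex_inj (inv_inj (@revK' m))).
  by apply: eq_bigl.
rewrite card_rev (card_tuple_cons n (fun s => P (rev s))); apply: eq_bigr => x _.
rewrite (card_rev n (fun s => P (rev (x :: s)))); apply: eq_card => t.
by rewrite !inE rev_cons revK.
Qed.

(** Since [k < n], the last entry is not [a]: it is a maximal element of [Q] that is not below [a],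
    and dropping it keeps the position of [a]. *)
Lemma linext_tuples_rcons a k n Q : a \notin Q -> k < n ->
  linext_tuples a k n.+1 (a |: Q) =
  \sum_(x | extremal Q (false, x) && ~~ below false a x)
    linext_tuples a k n (a |: (Q :\ x)).
Proof.
move=> aQ kn; rewrite /linext_tuples.
rewrite (card_tuple_rcons n (fun s => linext_seq (a |: Q) s && (index a s == k))).
rewrite [RHS]big_mkcond; apply: eq_bigr => x _.
have [xa|xa] := eqVneq x a.
  have -> : extremal Q (false, x) = false by rewrite /extremal /= xa (negPf aQ).
  apply: eq_card0 => t; rewrite !inE; apply/negP => /andP[]; rewrite linext_seq_rcons.
  case/and3P=> _ _ /linext_seq_mem mem.
  have /negPf at' : a \notin t by rewrite mem !inE xa eqxx.
  rewrite -cats1 index_cat at' /= xa eqxx size_tuple addn0 => /eqP nk.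
  by rewrite nk ltnn in kn.
have setE : (a |: Q) :\ x = a |: (Q :\ x).
  by apply/setP => y; rewrite !inE; case: (eqVneq y a) => [->|//]; rewrite eq_sym xa.
have extE : (x \in a |: Q) && [forall y in a |: Q, ~~ (x < y)%O] =
    extremal Q (false, x) && ~~ below false a x.
  rewrite /extremal /= !inE (negPf xa) -andbA; congr (_ && _).
  apply/forall_inP/andP => [H|[/forall_inP H xa'] y].
    split; last by apply: H; rewrite !inE eqxx.
    by apply/forall_inP => y yQ; apply: H; rewrite !inE yQ orbT.
  by rewrite !inE => /predU1P[->//|/H].
rewrite -extE; case: ifPn => [ok|nok]; last first.
  by apply: eq_card0 => t; rewrite !inE linext_seq_rcons andbA (negPf nok).
apply: eq_card => t; rewrite !inE linext_seq_rcons andbA ok setE /=.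
case tE : (linext_seq _ t) => //=.
by rewrite -cats1 index_cat (linext_seq_mem tE) !inE eqxx.
Qed.

Lemma linext_tuples_cons a k n Q : a \notin Q ->
  linext_tuples a k.+1 n.+1 (a |: Q) =
  \sum_(x | extremal Q (true, x) && ~~ below true a x)
    linext_tuples a k n (a |: (Q :\ x)).
Proof.
move=> aQ; rewrite /linext_tuples.
rewrite (card_tuple_cons n (fun s => linext_seq (a |: Q) s && (index a s == k.+1))).
rewrite [RHS]big_mkcond; apply: eq_bigr => x _.
have [xa|xa] := eqVneq x a.
  have -> : extremal Q (true, x) = false by rewrite /extremal /= xa (negPf aQ).
  by apply: eq_card0 => t; rewrite !inE /= xa eqxx andbF.
have setE : (a |: Q) :\ x = a |: (Q :\ x).
  by apply/setP => y; rewrite !inE; case: (eqVneq y a) => [->|//]; rewrite eq_sym xa.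
have extE : (x \in a |: Q) && [forall y in a |: Q, ~~ (y < x)%O] =
    extremal Q (true, x) && ~~ below true a x.
  rewrite /extremal /= !inE (negPf xa) -andbA; congr (_ && _).
  apply/forall_inP/andP => [H|[/forall_inP H xa'] y].
    split; last by apply: H; rewrite !inE eqxx.
    by apply/forall_inP => y yQ; apply: H; rewrite !inE yQ orbT.
  by rewrite !inE => /predU1P[->//|/H].
rewrite -extE; case: ifPn => [ok|nok]; last first.
  by apply: eq_card0 => t; rewrite !inE linext_seq_cons andbA (negPf nok).
by apply: eq_card => t; rewrite !inE linext_seq_cons andbA ok setE /= (negPf xa).
Qed.

Lemma linext_tuples1 a : linext_tuples a 0 1 [set a] = 1.
Proof.
rewrite /linext_tuples -[RHS](cards1 [tuple a]); apply: eq_card => t; rewrite !inE.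
apply/idP/eqP => [/andP[/linext_seq_mem mem _]|->].
  apply: val_inj => /=; case: t mem => -[|y [|z s]] //= _ mem.
  by have := mem y; rewrite !inE eqxx => /esym/eqP->.
rewrite /= eqxx andbT /linext_seq /= andbT.
by apply/forallP => y; rewrite !inE.
Qed.

(** The [j] entries after [a] are peeled off from the end, then the [i] entries before it from the
    front, until only [a] is left. *)
Lemma eps_removal0_linext (R : realFieldType) a j i Q : a \notin Q -> #|Q| = j + i ->
  eps_removal a (0%R : R) (nseq j false ++ nseq i true) Q =
  ((linext_tuples a i (j + i).+1 (a |: Q))%:R)%R.
Proof.
have cD (Q' : {set T}) (x : bool * T) m : extremal Q' x -> #|Q'| = m.+1 -> #|Q' :\ x.2| = m.
  by move=> /extremal_in xQ; rewrite (cardsD1 x.2 Q') xQ => -[].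
elim: j Q => [|j IHj] Q aQ /=; last first.
  rewrite addSn => cQ; rewrite eps_removal0_cons linext_tuples_rcons //; last by lia.
  rewrite natr_sum; apply: eq_bigr => x /andP[xe _]; apply: IHj.
    by rewrite !inE negb_and aQ orbT.
  exact: (cD _ (false, x)).
elim: i Q aQ => [|i IHi] Q aQ.
  by move=> /eqP; rewrite cards_eq0 => /eqP->; rewrite setU0 linext_tuples1.
move=> cQ; rewrite /= eps_removal0_cons linext_tuples_cons //.
rewrite natr_sum; apply: eq_bigr => x /andP[xe _]; apply: IHi.
  by rewrite !inE negb_and aQ orbT.
exact: (cD _ (true, x)).
Qed.

Lemma linext_countE a k A : a \in A -> linext_count a k.+1 A = linext_tuples a k #|A| A.
Proof.
move=> aA.
pose S := {u : T | u \in A}.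
(* Lists the elements by label; the default [a] is never reached when [g] is surjective. The inverse
   sends an element to its index. *)
pose G (g : {ffun S -> 'I_#|A|}) : #|A|.-tuple T :=
  [tuple odflt a (omap val [pick u | g u == i]) | i < #|A|].
have GE (g : {ffun S -> 'I_#|A|}) u : injective g -> tnth (G g) (g u) = val u.
  move=> ginj; rewrite tnth_mktuple; case: pickP => [u' /eqP/ginj->//|/(_ u)].
  by rewrite eqxx.
have GEn (g : {ffun S -> 'I_#|A|}) u : injective g -> nth a (G g) (g u) = val u.
  by move=> ginj; rewrite -tnth_nth GE.
rewrite /linext_count /linext_tuples -(card_in_imset (f := G)); last first.
  move=> g g'; rewrite !inE => /andP[/and3P[/injectiveP gi _ _] _].
  move=> /andP[/and3P[/injectiveP g'i /forallP g's _] _] GG.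
  apply/ffunP => u; have /existsP[u' /eqP u'E] := g's (g u).
  have : tnth (G g') (g u) = val u by rewrite -GG GE.
  by rewrite -u'E GE // => /val_inj <-; rewrite u'E.
apply: eq_card => t; rewrite !inE; apply/imsetP/idP.
  case=> g; rewrite inE => /andP[/and3P[/injectiveP gi /forallP gs /forallP go]].
  move=> /existsP[ua /andP[/eqP uaE /eqP[gk]]] ->.
  have inv i : exists u, g u = i by have /existsP[u /eqP] := gs i; exists u.
  have Gu : uniq (G g).
    apply/tuple_uniqP => i j; have [u <-] := inv i; have [v <-] := inv j.
    by rewrite !GE // => /val_inj->.
  apply/andP; split; last first.
    by rewrite -uaE -(GEn g) // index_uniq // ?size_tuple // gk.
  apply/and3P; split=> //.
    apply/forallP => x; apply/eqP; apply/idP/idP => [/tnthP[i ->]|xA].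
      by have [u <-] := inv i; rewrite GE // (valP u).
    by apply/tnthP; exists (g (Sub x xA)); rewrite GE.
  apply/(pairwiseP a) => i j; rewrite !inE size_tuple => ilt jlt ij.
  have [u uE] := inv (Ordinal ilt); have [v vE] := inv (Ordinal jlt).
  rewrite -[i]/(nat_of_ord (Ordinal ilt)) -[j in nth _ _ j]/(nat_of_ord (Ordinal jlt)).
  rewrite -uE -vE !GEn //; apply/negP => vu.
  have /forallP/(_ u)/implyP/(_ vu) := go v.
  by rewrite uE vE /= ltnNge ltnW.
move=> /andP[tl tk]; have mem := linext_seq_mem tl.
case/and3P: tl => tu _ /(pairwiseP a) tp.
have lt (u : S) : index (val u) t < #|A|.
  by rewrite -[X in _ < X](size_tuple t) index_mem mem (valP u).
pose g : {ffun S -> 'I_#|A|} := [ffun u => Ordinal (lt u)].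
have gE u : nat_of_ord (g u) = index (val u) t by rewrite ffunE.
have gt i : g (Sub (tnth t i) (etrans (esym (mem _)) (mem_tnth i t))) = i.
  by apply: ord_inj; rewrite gE /= (tnth_nth a) index_uniq // size_tuple.
have gi : injective g.
  move=> u v guv; apply: val_inj.
  have : index (val u) t = index (val v) t by rewrite -!gE guv.
  by move/(congr1 (nth a t)); rewrite !nth_index ?mem ?(valP u) ?(valP v).
exists g.
  rewrite inE; apply/andP; split; last first.
    by apply/existsP; exists (Sub a aA); rewrite /= eqxx gE /= eqSS.
  apply/and3P; split; first exact/injectiveP.
    by apply/forallP => i; apply/existsP; eexists; apply/eqP; apply: (gt i).
  apply/forallP => u; apply/forallP => v; apply/implyP => uv.
  rewrite ltnNge leq_eqVlt; apply/norP; split.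
    by apply: contraTneq uv => /val_inj/gi->; rewrite ltxx.
  apply/negP => vu; have := tp (g v) (g u).
  rewrite !inE size_tuple !ltn_ord => /(_ isT isT vu).
  by rewrite !gE !nth_index ?mem ?(valP u) ?(valP v) // uv.
by apply: eq_from_tnth => i; rewrite -{2}(gt i) GE.
Qed.

End Tuples.

Theorem theorem6p3 (d : Order.disp_t) (T : finPOrderType d) (a : T) (k : nat)
    (x y : T) :
  2 < #|T| ->
  1 <= k <= #|T| - 2 ->
  x != y ->
  minimal_in [set~ a] x ->
  minimal_in [set~ a] y ->
  linext_count a k [set: T] * linext_count a k ([set: T] :\ x :\ y)
    <= 2 * (linext_count a k ([set: T] :\ x) * linext_count a k ([set: T] :\ y)).
Proof.
move=> T2 /andP[k1 kT] xy [xa xmin] [ya ymin].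
set Q : {set T} := [set~ a].
have aQ : a \notin Q by rewrite !inE eqxx.
have xe : extremal Q (true, x) by apply/extremalP.
have ye : extremal Q (true, y) by apply/extremalP.
have cQ : #|Q| = #|T|.-1 by rewrite cardsC1.
case: k k1 kT => // i _ kT.
(* The number of elements after [a] once [x] and [y] are gone; the bound on [k] prevents
   truncation. *)
pose j := #|T| - 3 - i.
pose ls := nseq j false ++ nseq i true.
have cls : size ls = j + i by rewrite size_cat !size_nseq.
have cQls : #|Q| = (size ls).+2 by rewrite cQ cls /j; lia.
have T_Q : [set: T] = a |: Q by apply/setP => z; rewrite !inE; case: eqVneq.
have link (Q' : {set T}) m : a \notin Q' -> #|Q'| = m + i ->
    ((linext_count a i.+1 (a |: Q'))%:R = eps_removal a (0 : rat) (nseq m false ++ nseq i true) Q')%R.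
  move=> aQ' cQ'; rewrite eps_removal0_linext // linext_countE ?setU11 //.
  by rewrite cardsU1 aQ' cQ'.
have D1 (z : T) (Q' : {set T}) : z != a -> (a |: Q') :\ z = a |: (Q' :\ z).
  by move=> za; apply/setP => t; rewrite !inE; case: (eqVneq t a) => [->|//]; rewrite eq_sym za.
have [xa' ya'] : x != a /\ y != a by move: xa ya; rewrite !inE.
have cx : #|Q :\ x| = j.+1 + i by move: cQls; rewrite cls (cardsD1 x Q) xa addSn => -[].
have cy : #|Q :\ y| = j.+1 + i by move: cQls; rewrite cls (cardsD1 y Q) ya addSn => -[].
have cxy : #|Q :\ x :\ y| = j + i.
  by move: cx; rewrite (cardsD1 y (Q :\ x)) !inE eq_sym xy ya' /= addSn => -[].
have aD (z : T) (Q' : {set T}) : a \notin Q' -> a \notin Q' :\ z by move=> H; rewrite !inE negb_and H orbT.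
(* The two extra removals are from above although [x] and [y] are minimal: deleting [x] or [y] then
   shortens only the part after [a], so all four counts keep the position [k]. *)
have := @eps_removal0_ineq rat d T a false ls Q true x y cQls xy xe ye.
rewrite T_Q !D1 // -(ler_nat rat) !natrM.
have cQ2 : #|Q| = j.+2 + i by rewrite cQls cls !addSn.
by rewrite (link Q j.+2) // (link (Q :\ x) j.+1) ?aD // (link (Q :\ y) j.+1) ?aD //
  (link (Q :\ x :\ y) j) ?aD.
Qed.
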